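(* Let $\mathbb{F}$ be an algebraically closed field, $q\in\mathbb{F}$ with $q\neq 0$, and $f,g\in\mathbb{F}[h]$. Let $\lambda,\lambda'\in\mathsf{S}_f$, $\mu\in\mathsf{T}_{q,g,\lambda}$, $\mu'\in\mathsf{T}_{q,g,\lambda'}$ and $\gamma,\gamma'\in\mathbb{F}^*$, with $|\lambda|,|\lambda'|,|\mu|,|\mu'|\geq 1$. Then there is an isomorphism of $\mathcal{H}_q(f,g)$-modules $$\mathsf{A}_{q,f,g}(\lambda,\mu)/\mathbb{F}[t^{\pm1}](t^{|\lambda||\mu|}-\gamma)\simeq\mathsf{A}_{q,f,g}(\lambda',\mu')/\mathbb{F}[t^{\pm1}](t^{|\lambda'||\mu'|}-\gamma')$$ if and only if $\gamma=\gamma'$ and there exist $0\leq i<|\lambda|$, $0\leq j<|\mu|$ such that $\lambda'(k)=\lambda(k+i)$ and $\mu'(k)=\mu(k+i+j|\lambda|)$ for all $k\in\mathbb{Z}$.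
   Context: $\mathcal{H}_q(f,g)$ is the unital associative $\mathbb{F}$-algebra generated by $x,y,h$ with defining relations $hx=xf(h)$, $yh=f(h)y$, $yx-qxy=g(h)$; modules are left modules. $\mathsf{S}_f$ is the set of functions $\lambda:\mathbb{Z}\to\mathbb{F}$ with $f(\lambda(i))=\lambda(i+1)$ for all $i\in\mathbb{Z}$; for $\lambda\in\mathsf{S}_f$, $|\lambda|\geq 0$ is the nonnegative generator of the subgroup $\{k\in\mathbb{Z}\mid\lambda(i)=\lambda(i+k)\ \forall i\in\mathbb{Z}\}$ of $\mathbb{Z}$. For $\lambda\in\mathsf{S}_f$, $\mathsf{T}_{q,g,\lambda}$ is the set of functions $\mu:\mathbb{Z}\to\mathbb{F}$ with $\mu(i+1)=q\mu(i)+g(\lambda(i))$ for all $i\in\mathbb{Z}$; for $\mu\in\mathsf{T}_{q,g,\lambda}$ the set $\{k\in\mathbb{Z}\mid\mu(k|\lambda|)=\mu(0)\}$ is a subgroup of $\mathbb{Z}$ (as $q\ne0$), and $|\mu|\geq 0$ denotes its nonnegative generator. For $\lambda\in\mathsf{S}_f$, $\mu\in\mathsf{T}_{q,g,\lambda}$, $\mathsf{A}_{q,f,g}(\lambda,\mu)$ is the module with underlying space the Laurent polynomials $\mathbb{F}[t^{\pm1}]$ and action $ht^i=\lambda(i)t^i$, $xt^i=t^{i+1}$, $yt^i=\mu(i)t^{i-1}$ ($i\in\mathbb{Z}$). When $|\lambda|,|\mu|\ge1$ and $\gamma\in\mathbb{F}^*$, the subspace $\mathbb{F}[t^{\pm1}](t^{|\lambda||\mu|}-\gamma)$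 (the ideal of $\mathbb{F}[t^{\pm1}]$ generated by $t^{|\lambda||\mu|}-\gamma$) is a submodule. *)

(* Defs.v *)
From HB Require Import structures.
From mathcomp Require Import all_boot all_order all_algebra.
From mathcomp Require Import finmap monalg.
From mathcomp Require Import boolp classical_sets.

Set Implicit Arguments.
Unset Strict Implicit.
Unset Printing Implicit Defensive.

Import GRing.Theory Order.TTheory Num.Theory.

Local Open Scope ring_scope.
Local Open Scope quotient_scope.

(* Several operations below are locked: unfolding sums over msupp makes failed
   conversion tests extremely slow.
   [linext phi] is the linear map sending the basis vector << k >> to phi k. *)
HB.lock Definition linext (R : comNzRingType) (K : choiceType) (V : lmodType R)
    (phi : K -> V) (v : {malg R[K]}) : V :=
  \sum_(k <- msupp v) v@_k *: phi k.
Arguments linext {R K V} phi v.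

Section LinExt.
Variables (R : comNzRingType) (K : choiceType) (V : lmodType R).
Implicit Types (phi : K -> V) (v : {malg R[K]}).

Lemma linextEw phi (d : {fset K}) v : (msupp v `<=` d)%fset ->
  linext phi v = \sum_(k <- d) v@_k *: phi k.
Proof.
move=> le; rewrite linext.unlock (big_fset_incl _ le) //= => k _ /mcoeff_outdom ->.
by rewrite scale0r.
Qed.

Fact linext_is_linear phi : linear (linext phi).
Proof.
move=> c u v.
have le1 : (msupp u `<=` msupp u `|` msupp v)%fset by apply: fsubsetUl.
have le2 : (msupp v `<=` msupp u `|` msupp v)%fset by apply: fsubsetUr.
have le3 : (msupp (c *: u + v) `<=` msupp u `|` msupp v)%fset.
  apply: fsubset_trans (msuppD_le _ _) _; apply: fsetSU; exact: msuppZ_le.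
rewrite (linextEw _ le1) (linextEw _ le2) (linextEw _ le3).
rewrite scaler_sumr -big_split; apply: eq_bigr => k _.
by rewrite mcoeffD mcoeffZ scalerDl scalerA.
Qed.

HB.instance Definition _ phi :=
  GRing.isLinear.Build R {malg R[K]} V *:%R (linext phi) (linext_is_linear phi).

Lemma linextU phi k : linext phi << k >> = phi k.
Proof.
by rewrite (linextEw _ msuppU_le) big_seq_fset1 mcoeffUU scale1r.
Qed.

Lemma malgUZ (c : R) (k : K) : << c *g k >> = c *: << k >> :> {malg R[K]}.
Proof. by apply/malgP => j; rewrite mcoeffZ !mcoeffU mulrnAr mulr1. Qed.

Lemma malg_ind_lin (P : {malg R[K]} -> Prop) :
  P 0 -> (forall c k v, P v -> P (c *: << k >> + v)) -> forall v, P v.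
Proof.
move=> P0 PD v; rewrite [v]monalgE; elim: (enum_fset _) => [|k s IH].
  by rewrite big_nil.
by rewrite big_cons malgUZ; apply: PD.
Qed.

End LinExt.

Lemma eq_linmalg (R : comNzRingType) (K : choiceType) (V : lmodType R)
    (a b : {linear {malg R[K]} -> V}) :
  (forall k, a << k >> = b << k >>) -> a =1 b.
Proof.
by move=> eab; elim/malg_ind_lin => [|c k v IH];
  rewrite ?linear0 // !linearP eab IH.
Qed.

(* Laurent polynomials: finitely supported combinations of t^i = << i >>,
   i : int, with the product determined by t^i * t^j = t^(i + j). *)
Definition laurent (R : comNzRingType) := {malg R[int]}.
HB.instance Definition _ (R : comNzRingType) := GRing.Lmodule.on (laurent R).

Definition tpow (R : comNzRingType) (i : int) : laurent R := << i >>.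

HB.lock Definition laurent_mul (R : comNzRingType) (p r : laurent R) :
  laurent R := linext (fun i => linext (fun j => tpow R (i + j)) r) p.
Arguments laurent_mul {R} p r.

Section Laurent.
Variable R : comNzRingType.
Implicit Types (p r s : laurent R).

Local Notation tpow := (tpow R).

Local Notation "p *L r" := (laurent_mul p r) (at level 40).

Lemma laurent_mulDl : left_distributive (@laurent_mul R) +%R.
Proof. by move=> p r s; rewrite laurent_mul.unlock linearD. Qed.

Lemma laurent_mulZl c p r : (c *: p) *L r = c *: (p *L r).
Proof. by rewrite laurent_mul.unlock linearZ. Qed.

Lemma laurent_mulPr p c r s : p *L (c *: r + s) = c *: (p *L r) + p *L s.
Proof.
elim/malg_ind_lin: p => [|d k p IH].
  by rewrite laurent_mul.unlock !linear0 addr0.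
rewrite !laurent_mulDl !laurent_mulZl IH scalerDr addrACA; congr (_ + _).
by rewrite laurent_mul.unlock !linextU linearP scalerDr !scalerA mulrC.
Qed.

Lemma laurent_mul_tpow i j : tpow i *L tpow j = tpow (i + j).
Proof. by rewrite laurent_mul.unlock !linextU. Qed.

Lemma laurent_mul0l r : 0 *L r = 0.
Proof. by rewrite laurent_mul.unlock linear0. Qed.

Lemma laurent_mul0r p : p *L 0 = 0.
Proof.
have := laurent_mulPr p (-1) 0 0.
by rewrite !scaleN1r addr0 oppr0 addNr.
Qed.

Lemma laurent_mulPl c p r s : (c *: p + r) *L s = c *: (p *L s) + r *L s.
Proof. by rewrite laurent_mulDl laurent_mulZl. Qed.

Lemma laurent_mulC : commutative (@laurent_mul R).
Proof.
move=> p r; elim/malg_ind_lin: p => [|c i p IH].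
  by rewrite laurent_mul0l laurent_mul0r.
have E : << i >> *L r = r *L << i >>.
  elim/malg_ind_lin: r {IH} => [|d j r IH].
    by rewrite laurent_mul0l laurent_mul0r.
  rewrite (laurent_mulPl d << j >> r) (laurent_mulPr _ d << j >> r) IH.
  by rewrite (laurent_mul_tpow i j) (laurent_mul_tpow j i) (addrC i j).
by rewrite (laurent_mulPl c << i >> p) (laurent_mulPr r c << i >> p) IH E.
Qed.

Lemma laurent_mulA : associative (@laurent_mul R).
Proof.
move=> p r s; elim/malg_ind_lin: p => [|c i p IH].
  by rewrite !laurent_mul0l.
have E : << i >> *L (r *L s) = (<< i >> *L r) *L s.
  elim/malg_ind_lin: r {IH} => [|d j r IH].
    by rewrite laurent_mul0l !laurent_mul0r laurent_mul0l.
  have E : << i >> *L (<< j >> *L s) = (<< i >> *L << j >>) *L s.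
    elim/malg_ind_lin: s {IH} => [|e k s IH]; first by rewrite !laurent_mul0r.
    rewrite (laurent_mulPr << j >> e << k >> s).
    rewrite (laurent_mulPr << i >> e _ (<< j >> *L s)).
    rewrite (laurent_mulPr (<< i >> *L << j >>) e << k >> s) IH.
    rewrite (laurent_mul_tpow i j) (laurent_mul_tpow j k).
    by rewrite (laurent_mul_tpow i (j + k)) (laurent_mul_tpow (i + j) k) addrA.
  rewrite (laurent_mulPl d << j >> r s) (laurent_mulPr << i >> d << j >> r).
  by rewrite laurent_mulPr laurent_mulPl IH E.
rewrite (laurent_mulPl c << i >> p (r *L s)) (laurent_mulPl c << i >> p r).
by rewrite laurent_mulPl IH E.
Qed.

Lemma laurent_mul1l : left_id (tpow 0) laurent_mul.
Proof.
move=> p; elim/malg_ind_lin: p => [|c i p IH]; first exact: laurent_mul0r.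
by rewrite (laurent_mulPr _ c) IH (laurent_mul_tpow 0 i) add0r.
Qed.

Lemma laurent1_neq0 : tpow 0 != 0.
Proof. by apply/eqP/malgP=> /(_ 0) /eqP; rewrite mcoeffUU mcoeff0 oner_eq0. Qed.

HB.instance Definition _ := GRing.Zmodule_isComNzRing.Build (laurent R)
  laurent_mulA laurent_mulC laurent_mul1l laurent_mulDl laurent1_neq0.

Lemma laurent_scaleAl (c : R) p r : c *: (p * r) = (c *: p) * r.
Proof. by rewrite [RHS]laurent_mulZl. Qed.

HB.instance Definition _ :=
  GRing.Lmodule_isLalgebra.Build R (laurent R) laurent_scaleAl.
HB.instance Definition _ := GRing.Lalgebra_isComAlgebra.Build R (laurent R).

Lemma laurent_ind (P : laurent R -> Prop) :
  P 0 -> (forall c i p, P p -> P (c *: tpow i + p)) -> forall p, P p.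
Proof. exact: malg_ind_lin. Qed.

Lemma tpow0 : tpow 0 = 1. Proof. by []. Qed.

Lemma tpowD i j : tpow (i + j) = tpow i * tpow j.
Proof. by rewrite [RHS]laurent_mul_tpow. Qed.

End Laurent.

Section QuotientModule.
Variables (R : pzRingType) (V : lmodType R).

Fact submod_oppr_closed (S : submodClosed V) : oppr_closed S.
Proof. by move=> v Sv; rewrite -scaleN1r rpredZ. Qed.

Definition submod_pred (S : submodClosed V) : pred V := fun v => v \in S.

Fact submod_pred_zmod_closed S : zmod_closed (submod_pred S).
Proof.
split=> [|u v Su Sv]; first exact: (rpred0 S).
by apply: (@rpredD _ S) => //; apply: submod_oppr_closed.
Qed.
HB.instance Definition _ S :=
  GRing.isZmodClosed.Build V (submod_pred S) (submod_pred_zmod_closed S).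

Definition lquot (S : submodClosed V) := Quotient.quot (GRing.ZmodClosed.clone V (submod_pred S) _).

HB.instance Definition _ S := GRing.Zmodule.on (lquot S).

End QuotientModule.

HB.lock Definition lquot_pi (R : pzRingType) (V : lmodType R)
  (S : submodClosed V) (v : V) : lquot S := \pi_(Quotient.quot _) v.
Arguments lquot_pi {R V} S v.

HB.lock Definition lquot_repr (R : pzRingType) (V : lmodType R)
  (S : submodClosed V) (u : lquot S) : V := repr (u : Quotient.quot _).
Arguments lquot_repr {R V S} u.

HB.lock Definition lquot_scale (R : pzRingType) (V : lmodType R)
  (S : submodClosed V) (a : R) (u : lquot S) : lquot S :=
  lquot_pi S (a *: lquot_repr u).
Arguments lquot_scale {R V S} a u.

Section QuotientModuleTheory.
Variables (R : pzRingType) (V : lmodType R) (S : submodClosed V).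
Local Notation lquot_pi := (lquot_pi S).
Local Notation lquot_scale := (@lquot_scale R V S).

Lemma lquot_reprK (u : lquot S) : lquot_pi (lquot_repr u) = u.
Proof. by rewrite lquot_pi.unlock lquot_repr.unlock; exact: reprK. Qed.

Lemma lquot_piB : zmod_morphism lquot_pi.
Proof. by move=> u v; rewrite lquot_pi.unlock raddfB. Qed.
HB.instance Definition _ := GRing.isZmodMorphism.Build V (lquot S) lquot_pi lquot_piB.

Lemma lquot_eq u v : (lquot_pi u = lquot_pi v) <-> (u - v \in S).
Proof.
have -> : (u - v \in S) = (u - v \in submod_pred S) by [].
by rewrite lquot_pi.unlock Quotient.idealrBE; split => [/eqP|/eqP].
Qed.

Lemma lquot_scaleE a v : lquot_scale a (lquot_pi v) = lquot_pi (a *: v).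
Proof.
rewrite lquot_scale.unlock; apply/lquot_eq; rewrite -scalerBr rpredZ //; apply/lquot_eq.
by rewrite lquot_reprK.
Qed.

Fact lquot_scaleA a b u : lquot_scale a (lquot_scale b u) = lquot_scale (a * b) u.
Proof. by rewrite -[u]lquot_reprK !lquot_scaleE scalerA. Qed.

Fact lquot_scale1 : left_id 1 lquot_scale.
Proof. by move=> u; rewrite -[u]lquot_reprK lquot_scaleE scale1r. Qed.

Fact lquot_scaleDr : right_distributive lquot_scale +%R.
Proof.
move=> a u v; rewrite -[u]lquot_reprK -[v]lquot_reprK -raddfD !lquot_scaleE.
by rewrite scalerDr raddfD.
Qed.

Fact lquot_scaleDl u : {morph lquot_scale^~ u : a b / a + b}.
Proof.
by move=> a b; rewrite -[u]lquot_reprK !lquot_scaleE scalerDl raddfD.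
Qed.

HB.instance Definition _ := GRing.Zmodule_isLmodule.Build R (lquot S)
  lquot_scaleA lquot_scale1 lquot_scaleDr lquot_scaleDl.

Lemma lquot_piZ a v : lquot_pi (a *: v) = a *: lquot_pi v.
Proof. exact/esym/lquot_scaleE. Qed.

Lemma lquot_pi_is_scalable : scalable lquot_pi.
Proof. exact: lquot_piZ. Qed.
HB.instance Definition _ :=
  GRing.isScalable.Build R V (lquot S) *:%R lquot_pi lquot_pi_is_scalable.

End QuotientModuleTheory.

Lemma malg_scaleAr (K : monomType) (R : comNzRingType) (c : R)
  (a b : {malg R[K]}) : c *: (a * b) = a * (c *: b).
Proof.
apply/malgP => w; rewrite mcoeffZ mcoeffMl.
rewrite (@mcoeffMlw _ _ _ (msupp b) a (c *: b) _ (fsubset_refl _)); last first.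
  exact: msuppZ_le.
rewrite mulr_sumr; apply: eq_bigr => u _; rewrite mulr_sumr.
by apply: eq_bigr => v _; rewrite mcoeffZ mulrnAr mulrCA.
Qed.

Lemma malg_mulUU (K : monomType) (R : comNzRingType) (u v : K) :
  << u >> * << v >> = << mmul u v >> :> {malg R[K]}.
Proof. by rewrite malgM_def fgmulUU mul1r. Qed.

(* The free unital associative algebra on three letters. *)
Definition freealg (R : comNzRingType) := {malg R[{fmonom 'I_3}]}.

HB.lock Definition fword (R : comNzRingType) (w : {fmonom 'I_3}) : freealg R :=
  << w >>.

Section FreeAlgebra.
Variable R : comNzRingType.
HB.instance Definition _ := GRing.Lalgebra.on (freealg R).

Fact freealg_scaleAr (c : R) (a b : freealg R) : c *: (a * b) = a * (c *: b).
Proof. exact: malg_scaleAr. Qed.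
HB.instance Definition _ :=
  GRing.Lalgebra_isAlgebra.Build R (freealg R) freealg_scaleAr.
Local Notation fword := (fword R).


Lemma freealg_ind (P : freealg R -> Prop) :
  P 0 -> (forall c w a, P a -> P (c *: fword w + a)) -> forall a, P a.
Proof. by rewrite fword.unlock; exact: malg_ind_lin. Qed.

Lemma fwordM u w : fword u * fword w = fword (mmul u w).
Proof. by rewrite fword.unlock; exact: malg_mulUU. Qed.

Lemma fword1 : fword mone = 1. Proof. by rewrite fword.unlock. Qed.

Definition fgen (i : 'I_3) : freealg R := fword (fmu i).

Definition fX := fgen (inord 0).
Definition fY := fgen (inord 1).
Definition fH := fgen (inord 2).

End FreeAlgebra.

Arguments fX {R}.
Arguments fY {R}.
Arguments fH {R}.

(* The two-sided ideal generated by the elements satisfying rel. *)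
Inductive tsideal (R : pzRingType) (rel : R -> Prop) : R -> Prop :=
| TsGen r of rel r : tsideal rel r
| Ts0 : tsideal rel 0
| TsB r s of tsideal rel r & tsideal rel s : tsideal rel (r - s)
| TsM a r b of tsideal rel r : tsideal rel (a * r * b).

(* The defining relations: h x = x f(h), y h = f(h) y, y x - q x y = g(h). *)
Definition Hrel (F : fieldType) (q : F) (f g : {poly F}) (r : freealg F) :=
  [\/ r = fH * fX - fX * horner_alg fH f,
      r = fY * fH - horner_alg fH f * fY |
      r = fY * fX - q *: (fX * fY) - horner_alg fH g].

(* The action of the free algebra on V in which the letter i acts by op i. *)
HB.lock Definition free_act (R : comNzRingType) (V : lmodType R)
    (op : 'I_3 -> {linear V -> V}) (a : freealg R) (v : V) : V :=
  linext (fun w : {fmonom 'I_3} => foldr op v w) a.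
Arguments free_act {R V} op a v.

Section FreeAction.
Variables (R : comNzRingType) (V : lmodType R) (op : 'I_3 -> {linear V -> V}).
Local Notation free_act := (free_act op).

Lemma free_actD a b v : free_act (a + b) v = free_act a v + free_act b v.
Proof. by rewrite free_act.unlock; exact: linearD. Qed.

Lemma free_actB a b v : free_act (a - b) v = free_act a v - free_act b v.
Proof. by rewrite free_act.unlock; exact: linearB. Qed.

Lemma free_act0 v : free_act 0 v = 0.
Proof. by rewrite free_act.unlock; exact: linear0. Qed.

Lemma free_actZ c a v : free_act (c *: a) v = c *: free_act a v.
Proof. by rewrite free_act.unlock; exact: linearZ. Qed.

Lemma free_act_word w v : free_act (fword R w) v = foldr op v w.
Proof. by rewrite free_act.unlock fword.unlock; exact: linextU. Qed.

Lemma free_act1 v : free_act 1 v = v.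
Proof. by rewrite -fword1 free_act_word fm1. Qed.

Lemma free_act_gen i v : free_act (fgen R i) v = op i v.
Proof. by rewrite free_act_word fmU. Qed.

Fact word_act_is_linear (w : seq 'I_3) : linear (fun v => foldr op v w).
Proof. by move=> c u v; elim: w => //= i w ->; rewrite linearP. Qed.

Lemma free_act_is_linear a : linear (free_act a).
Proof.
move=> c u v; elim/freealg_ind: a => [|d w a IH].
  by rewrite !free_act0 scaler0 addr0.
rewrite !free_actD !free_actZ IH !free_act_word (word_act_is_linear w).
by rewrite !scalerDr addrACA !scalerA mulrC.
Qed.
HB.instance Definition _ a :=
  GRing.isLinear.Build R V V *:%R (free_act a) (free_act_is_linear a).

Lemma free_actM (a b : freealg R) v :
  free_act (a * b) v = free_act a (free_act b v).
Proof.
elim/freealg_ind: a => [|c w a IH]; first by rewrite mul0r !free_act0.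
rewrite mulrDl -scalerAl [LHS]free_actD [RHS]free_actD IH; congr (_ + _).
rewrite [LHS]free_actZ [RHS]free_actZ; congr (_ *: _) => {IH a c}.
elim/freealg_ind: b => [|c u b IH]; first by rewrite mulr0 !free_act0 linear0.
rewrite mulrDr -scalerAr [LHS]free_actD IH.
rewrite [X in _ = free_act _ X]free_actD [RHS]linearD; congr (_ + _).
rewrite [LHS]free_actZ [X in _ = _ X]free_actZ [RHS]linearZ; congr (_ *: _).
rewrite fwordM [LHS]free_act_word [X in _ = _ X]free_act_word.
by rewrite [RHS]free_act_word fmM foldr_cat.
Qed.

End FreeAction.

Lemma horner_algMXaddC (R : comNzRingType) (A : algType R) (a : A) p c :
  horner_alg a (p * 'X + c%:P) = horner_alg a p * a + c%:A.
Proof. by rewrite linearD rmorphM /= horner_algX horner_algC. Qed.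

Section HqDef.
Variables (F : fieldType) (q : F) (f g : {poly F}).

Definition Hideal : pred (freealg F) := fun a => `[< tsideal (Hrel q f g) a >].

Fact Hideal_zmod_closed : zmod_closed Hideal.
Proof.
split=> [|a b /asboolP Ia /asboolP Ib]; apply/asboolP; first exact: Ts0.
exact: TsB.
Qed.
HB.instance Definition _ :=
  GRing.isZmodClosed.Build (freealg F) Hideal Hideal_zmod_closed.

Lemma HidealM a r b : r \in Hideal -> a * r * b \in Hideal.
Proof. by move=> /asboolP Ir; apply/asboolP; apply: TsM. Qed.

Definition Hq :=
  Quotient.quot (GRing.ZmodClosed.clone (freealg F) Hideal _).
HB.instance Definition _ := GRing.Zmodule.on Hq.

End HqDef.

HB.lock Definition Hpi (F : fieldType) (q : F) (f g : {poly F})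
  (a : freealg F) : Hq q f g := \pi_(Quotient.quot _) a.
Arguments Hpi {F} q f g a.

HB.lock Definition Hlift (F : fieldType) (q : F) (f g : {poly F})
  (a : Hq q f g) : freealg F := repr (a : Quotient.quot _).
Arguments Hlift {F q f g} a.

HB.lock Definition Hmul (F : fieldType) (q : F) (f g : {poly F})
  (a b : Hq q f g) : Hq q f g := Hpi q f g (Hlift a * Hlift b).
Arguments Hmul {F q f g} a b.

HB.lock Definition Hscale (F : fieldType) (q : F) (f g : {poly F})
  (c : F) (a : Hq q f g) : Hq q f g := Hpi q f g (c *: Hlift a).
Arguments Hscale {F q f g} c a.

Section HqTheory.
Variables (F : fieldType) (q : F) (f g : {poly F}).
Local Notation Hideal := (Hideal q f g).
Local Notation Hq := (Hq q f g).
Local Notation Hpi := (Hpi q f g).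
Local Notation Hmul := (@Hmul F q f g).
Local Notation Hscale := (@Hscale F q f g).

Lemma HliftK (u : Hq) : Hpi (Hlift u) = u.
Proof. by rewrite Hpi.unlock Hlift.unlock; exact: reprK. Qed.

Fact HpiB : zmod_morphism Hpi.
Proof. by move=> u v; rewrite Hpi.unlock raddfB. Qed.
HB.instance Definition _ :=
  GRing.isZmodMorphism.Build (freealg F) Hq Hpi HpiB.

Lemma Hpi_eq a b : Hpi a = Hpi b <-> a - b \in Hideal.
Proof. by rewrite Hpi.unlock Quotient.idealrBE; split => [/eqP|/eqP]. Qed.

Section Action.
Variables (V : lmodType F) (op : 'I_3 -> {linear V -> V}).
Hypothesis op_rel : forall r, Hrel q f g r -> forall v, free_act op r v = 0.

Lemma free_act_ideal r : r \in Hideal -> forall v, free_act op r v = 0.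
Proof.
move=> /asboolP; elim=> {r} [||r s _ Ir _ Is v|a r b _ Ir v].
- exact: op_rel.
- exact: free_act0.
- by rewrite free_actB Ir Is subrr.
- by rewrite !free_actM Ir linear0.
Qed.

Definition Hact (a : Hq) (v : V) : V := free_act op (Hlift a) v.

Lemma HactE a v : Hact (Hpi a) v = free_act op a v.
Proof.
apply/eqP; rewrite -subr_eq0 -free_actB; apply/eqP/free_act_ideal/Hpi_eq.
exact: HliftK.
Qed.

End Action.

(* weighted shifts << k >> |-> c k *: << s k >> on a space with basis K *)
Definition wshift (K : choiceType) (s : K -> K) (c : K -> F) :
  {malg F[K]} -> {malg F[K]} := linext (fun k => c k *: << s k >>).
HB.instance Definition _ K s c := GRing.Linear.on (@wshift K s c).

Definition shift_op (K : choiceType) (sx sy : K -> K) (cx cy lam : K -> F)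
    (i : 'I_3) : {linear {malg F[K]} -> {malg F[K]}} :=
  let wsh s c := GRing.Linear.clone F _ _ _ (@wshift K s c) _ in
  if i == inord 0 then wsh sx cx else
  if i == inord 1 then wsh sy cy else wsh id lam.

Section ShiftRep.
Variables (K : choiceType) (sx sy : K -> K) (cx cy lam : K -> F).
Hypothesis relx : forall k, cx k * lam (sx k) = cx k * f.[lam k].
Hypothesis rely : forall k, cy k * lam k = cy k * f.[lam (sy k)].
Hypothesis relxy : forall k,
  (cx k * cy (sx k)) *: << sy (sx k) >> -
  (q * (cy k * cx (sy k))) *: << sx (sy k) >> = g.[lam k] *: << k >>
  :> {malg F[K]}.

Local Notation act := (free_act (shift_op sx sy cx cy lam)).

Lemma shift_actX k : act fX << k >> = cx k *: << sx k >>.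
Proof. by rewrite free_act_gen /shift_op eqxx; exact: linextU. Qed.

Lemma shift_actY k : act fY << k >> = cy k *: << sy k >>.
Proof.
rewrite free_act_gen /shift_op eqxx ifF; first exact: linextU.
by apply/eqP => /(congr1 val); rewrite /= !inordK.
Qed.

Lemma shift_actH k : act fH << k >> = lam k *: << k >>.
Proof.
rewrite free_act_gen /shift_op ifF; last first.
  by apply/eqP => /(congr1 val); rewrite /= !inordK.
rewrite ifF; last by apply/eqP => /(congr1 val); rewrite /= !inordK.
exact: linextU.
Qed.

Lemma shift_act_horner p k : act (horner_alg fH p) << k >> = p.[lam k] *: << k >>.
Proof.
elim/poly_ind: p => [|p c IH]; first by rewrite linear0 free_act0 horner0 scale0r.
rewrite linearD rmorphM /= horner_algX horner_algC free_actD free_actM.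
rewrite shift_actH linearZ /= IH free_actZ free_act1.
by rewrite hornerMXaddC scalerA scalerDl mulrC.
Qed.

Lemma shift_op_rel r : Hrel q f g r -> forall v, act r v = 0.
Proof.
move=> rel_r; suff rK k : act r << k >> = 0.
  elim/malg_ind_lin=> [|c k v IH]; first by rewrite linear0.
  by rewrite linearP /= rK scaler0 add0r.
case: rel_r => ->; rewrite [LHS]free_actB; apply/eqP; rewrite subr_eq0; apply/eqP.
- rewrite [LHS]free_actM [RHS]free_actM shift_actX shift_act_horner.
  rewrite [LHS]linearZ [RHS]linearZ /= shift_actX shift_actH.
  by rewrite !scalerA relx mulrC.
- rewrite [LHS]free_actM [RHS]free_actM shift_actY shift_actH.
  rewrite [LHS]linearZ [RHS]linearZ /= shift_actY shift_act_horner.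
  by rewrite !scalerA -rely mulrC.
- rewrite [LHS]free_actB [X in _ - X]free_actZ [X in X - _]free_actM.
  rewrite [X in _ - _ *: X]free_actM shift_act_horner shift_actX shift_actY.
  rewrite [X in X - _]linearZ [X in _ - _ *: X]linearZ /= shift_actX shift_actY.
  by rewrite !scalerA -mulrA relxy.
Qed.

End ShiftRep.

Definition Hone : Hq := Hpi 1.

Lemma HmulE a b : Hmul (Hpi a) (Hpi b) = Hpi (a * b).
Proof.
have [Ia Ib] : Hlift (Hpi a) - a \in Hideal /\ Hlift (Hpi b) - b \in Hideal.
  by split; apply/Hpi_eq; exact: HliftK.
rewrite Hmul.unlock; apply/Hpi_eq; set a' := Hlift _; set b' := Hlift _.
have -> : a' * b' - a * b = 1 * (a' - a) * b' + a * (b' - b) * 1.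
  by rewrite mul1r mulr1 mulrBl mulrBr addrA subrK.
by apply: rpredD; apply: HidealM.
Qed.

Lemma HscaleE c a : Hscale c (Hpi a) = Hpi (c *: a).
Proof.
rewrite Hscale.unlock; apply/Hpi_eq; rewrite -scalerBr -mulr_algl -[X in X \in _]mulr1; apply: HidealM.
by apply/Hpi_eq; exact: HliftK.
Qed.

Fact HmulA : associative Hmul.
Proof. by move=> a b c; rewrite -[a]HliftK -[b]HliftK -[c]HliftK !HmulE mulrA. Qed.
Fact Hmul1 : left_id Hone Hmul.
Proof. by move=> a; rewrite -[a]HliftK HmulE mul1r. Qed.
Fact Hmulr1 : right_id Hone Hmul.
Proof. by move=> a; rewrite -[a]HliftK HmulE mulr1. Qed.
Fact HmulDl : left_distributive Hmul +%R.
Proof.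
move=> a b c; rewrite -[a]HliftK -[b]HliftK -[c]HliftK -raddfD !HmulE mulrDl.
by rewrite raddfD.
Qed.
Fact HmulDr : right_distributive Hmul +%R.
Proof.
move=> a b c; rewrite -[a]HliftK -[b]HliftK -[c]HliftK -raddfD !HmulE mulrDr.
by rewrite raddfD.
Qed.

Fact Hone_neq0 : Hone != 0.
Proof.
apply/eqP; rewrite -[RHS](raddf0 Hpi) => /Hpi_eq; rewrite subr0 => I1.
pose lam k := iter k (horner f) 0.
pose mu := fix mu k := if k is k'.+1 then q * mu k' + g.[lam k'] else 0.
have := @free_act_ideal _ (shift_op S predn (fun=> 1) mu lam) _ _ I1 << 0%N >>.
rewrite free_act1 => E; suff : << 0%N >> = 0 :> {malg F[nat]}.
  by move/malgP/(_ 0%N)/eqP; rewrite mcoeffUU mcoeff0 oner_eq0.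
apply: E => r rel_r v; apply: shift_op_rel => // -[|k] //=.
- by rewrite !mul0r.
- by rewrite !(mulr0, mul0r, mul1r, add0r, scale0r, subr0).
- by rewrite !(mul1r, mulr1) -scalerBl addrAC subrr add0r.
Qed.

HB.instance Definition _ := GRing.Zmodule_isNzRing.Build Hq
  HmulA Hmul1 Hmulr1 HmulDl HmulDr Hone_neq0.

Fact HscaleA a b u : Hscale a (Hscale b u) = Hscale (a * b) u.
Proof. by rewrite -[u]HliftK !HscaleE scalerA. Qed.
Fact Hscale1 : left_id 1 Hscale.
Proof. by move=> u; rewrite -[u]HliftK HscaleE scale1r. Qed.
Fact HscaleDr : right_distributive Hscale +%R.
Proof.
move=> a u v; rewrite -[u]HliftK -[v]HliftK -raddfD !HscaleE.
by rewrite scalerDr raddfD.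
Qed.
Fact HscaleDl u : {morph Hscale^~ u : a b / a + b}.
Proof. by move=> a b; rewrite -[u]HliftK !HscaleE scalerDl raddfD. Qed.
HB.instance Definition _ := GRing.Zmodule_isLmodule.Build F Hq
  HscaleA Hscale1 HscaleDr HscaleDl.

Fact HscaleAl c a b : Hscale c (Hmul a b) = Hmul (Hscale c a) b.
Proof.
rewrite -[a]HliftK -[b]HliftK HmulE.
by rewrite (HscaleE c (Hlift a)) [LHS]HscaleE [RHS]HmulE scalerAl.
Qed.
HB.instance Definition _ := GRing.Lmodule_isLalgebra.Build F Hq HscaleAl.

Fact HscaleAr c a b : Hscale c (Hmul a b) = Hmul a (Hscale c b).
Proof.
rewrite -[a]HliftK -[b]HliftK HmulE.
by rewrite (HscaleE c (Hlift b)) [LHS]HscaleE [RHS]HmulE scalerAr.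
Qed.
HB.instance Definition _ := GRing.Lalgebra_isAlgebra.Build F Hq HscaleAr.

Fact Hpi_is_monoid_morphism : monoid_morphism Hpi.
Proof. by split=> [|a b]; [|exact/esym/HmulE]. Qed.
HB.instance Definition _ :=
  GRing.isMonoidMorphism.Build (freealg F) Hq Hpi Hpi_is_monoid_morphism.
Fact Hpi_is_scalable : scalable Hpi.
Proof. by move=> c a; exact/esym/HscaleE. Qed.
HB.instance Definition _ :=
  GRing.isScalable.Build F (freealg F) Hq *:%R Hpi Hpi_is_scalable.

Definition HX : Hq := Hpi fX.
Definition HY : Hq := Hpi fY.
Definition HH : Hq := Hpi fH.

Lemma Hpi_horner p : Hpi (horner_alg fH p) = horner_alg HH p.
Proof.
elim/poly_ind: p => [|p c IH]; first by rewrite !linear0.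
rewrite (horner_algMXaddC fH) (horner_algMXaddC HH).
rewrite [LHS]raddfD /=.
congr (_ + _).
  by rewrite [LHS]rmorphM /= IH.
by rewrite [LHS]linearZ /= [Hpi 1]rmorph1.
Qed.

Lemma Hpi_rel r : Hrel q f g r -> Hpi r = 0.
Proof.
by move=> rel_r; rewrite -(raddf0 Hpi); apply/Hpi_eq/asboolP; rewrite subr0; apply: TsGen.
Qed.

Lemma HpiM a b : Hpi (a * b) = Hpi a * Hpi b.
Proof. exact/esym/HmulE. Qed.

Lemma HpiZ c a : Hpi (c *: a) = c *: Hpi a.
Proof. exact/esym/HscaleE. Qed.

Lemma HHX : HH * HX = HX * horner_alg HH f.
Proof.
have /Hpi_rel E : Hrel q f g (fH * fX - fX * horner_alg fH f) by apply: Or31.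
apply/eqP; rewrite -subr_eq0 -E [X in _ == X]raddfB /=.
by rewrite {1}(HpiM fH fX) {1}(HpiM fX (horner_alg fH f)) Hpi_horner.
Qed.

Lemma HYH : HY * HH = horner_alg HH f * HY.
Proof.
have /Hpi_rel E : Hrel q f g (fY * fH - horner_alg fH f * fY) by apply: Or32.
apply/eqP; rewrite -subr_eq0 -E [X in _ == X]raddfB /=.
by rewrite {1}(HpiM fY fH) {1}(HpiM (horner_alg fH f) fY) Hpi_horner.
Qed.

Lemma HYX : HY * HX - q *: (HX * HY) = horner_alg HH g.
Proof.
have /Hpi_rel E : Hrel q f g (fY * fX - q *: (fX * fY) - horner_alg fH g).
  by apply: Or33.
apply/eqP; rewrite -subr_eq0 -E [X in _ == X]raddfB /= Hpi_horner.
rewrite [Hpi (_ - _)]raddfB /= {1}(HpiZ q (fX * fY)).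
by rewrite {1}(HpiM fY fX) {1}(HpiM fX fY).
Qed.

End HqTheory.

Local Open Scope classical_set_scope.

(* The nonnegative generator of a subgroup of int (0 if S is not a subgroup). *)
Definition zgen (S : set int) : nat :=
  xget 0%N [set n : nat | forall k : int, S k <-> (n%:Z %| k)%Z].

Lemma zgenP (S : set int) : S 0 -> (forall a b, S a -> S b -> S (a - b)) ->
  forall k, S k <-> ((zgen S)%:Z %| k)%Z.
Proof.
move=> S0 SB.
have SN a : S a -> S (- a) by move=> Sa; rewrite -sub0r; exact: SB.
have SD a b : S a -> S b -> S (a + b).
  by move=> Sa Sb; rewrite -[b]opprK; apply: SB => //; apply: SN.
have SMn n a : S a -> S (n%:Z * a).
  move=> Sa; elim: n => [|n IH]; first by rewrite mul0r.
  by rewrite intS mulrDl mul1r; apply: SD.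
have SM b a : S a -> S (b * a).
  by case: b => n Sa; [exact: SMn|rewrite NegzE mulNr; apply/SN/SMn].
suff [n nP] : exists n : nat, forall k : int, S k <-> (n%:Z %| k)%Z.
  pose D := [set n : nat | forall k : int, S k <-> (n%:Z %| k)%Z].
  by have : D (zgen S) by apply: (@xgetPex _ 0%N D); exists n.
have [[n0 n0_gt0 Sn0]|noS] := pselect (exists2 n : nat, (0 < n)%N & S n%:Z).
  have ex : exists n : nat, (0 < n)%N && `[< S n%:Z >].
    by exists n0; rewrite n0_gt0; apply/asboolP.
  case: (ex_minnP ex) => n /andP[n_gt0 /asboolP Sn] n_min; exists n => k.
  split=> [Sk|/dvdzP[b ->]]; last exact: SM.
  have Smod : S (k %% n%:Z)%Z.
    by rewrite /modz; apply: SB => //; apply: SM.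
  have n_neq0 : n%:Z != 0 by move: n_gt0; rewrite lt0n.
  have := modz_ge0 k n_neq0; have := ltz_mod k n_neq0.
  move: Smod; case E : (k %% n%:Z)%Z => [r|//] Sr ltr _.
  have [r0|r_gt0] := posnP r.
    by apply/dvdzP; exists (k %/ n%:Z)%Z; rewrite [LHS](divz_eq k n%:Z) E r0 addr0.
  have := n_min r; rewrite r_gt0 (asboolT Sr) => /(_ isT).
  by rewrite leqNgt; move: ltr; rewrite ger0_norm // ltz_nat => ->.
exists 0%N => k; rewrite dvd0z; split=> [Sk|/eqP-> //].
apply/eqP; case: k Sk => [[|n]|n] Sk //.
  by case: noS; exists n.+1.
case: noS; exists n.+1 => //.
by have := SN _ Sk; rewrite NegzE opprK.
Qed.

Section Sequences.
Variables (F : fieldType) (q : F) (f g : {poly F}).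

Record Sf := MkSf {
  Sf_fun :> int -> F;
  Sf_eq : forall i, f.[Sf_fun i] = Sf_fun (i + 1)
}.

(* |lam| *)
Definition Sper (lam : int -> F) : nat :=
  zgen [set k : int | forall i, lam i = lam (i + k)].

Record Tqg (lam : int -> F) := MkTqg {
  Tqg_fun :> int -> F;
  Tqg_eq : forall i, Tqg_fun (i + 1) = q * Tqg_fun i + g.[lam i]
}.

(* |mu| *)
Definition Tper (lam mu : int -> F) : nat :=
  zgen [set k : int | mu (k * (Sper lam)%:Z) = mu 0].

Lemma SperP lam (k : int) : (forall i, lam i = lam (i + k)) <-> ((Sper lam)%:Z %| k)%Z.
Proof.
apply: (zgenP (S := [set k : int | forall i, lam i = lam (i + k)])) => /=.
  by move=> i; rewrite addr0.
move=> a b La Lb i; rewrite -{1}[i](subrK b) -Lb (La (i - b)).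
by rewrite -addrA [- b + a]addrC.
Qed.

Lemma Tqg_shift lam (mu : Tqg lam) (d : int) : q != 0 ->
  ((Sper lam)%:Z %| d)%Z -> mu d = mu 0 -> forall i, mu (i + d) = mu i.
Proof.
move=> q0 /SperP lamd mud i.
have step j : mu (j + 1 + d) - mu (j + 1) = q * (mu (j + d) - mu j).
  by rewrite addrAC !Tqg_eq -lamd opprD addrACA subrr addr0 mulrBr.
apply/eqP; rewrite -subr_eq0; elim/int_ind: i => [|n IH|n IH].
- by rewrite add0r mud subrr.
- by rewrite -addn1 PoszD step (eqP IH) mulr0.
- move: IH; rewrite -[X in mu (X + d) - mu X == 0](_ : - n.+1%:Z + 1 = _).
    by rewrite step mulf_eq0 (negPf q0).
  by rewrite -addn1 PoszD opprD subrK.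
Qed.

Lemma TperP lam (mu : Tqg lam) (k : int) : q != 0 ->
  mu (k * (Sper lam)%:Z) = mu 0 <-> ((Tper lam mu)%:Z %| k)%Z.
Proof.
move=> q0.
apply: (zgenP (S := [set k : int | mu (k * (Sper lam)%:Z) = mu 0])) => /=.
  by rewrite mul0r.
move=> a b Sa Sb; rewrite mulrBl.
have dv c : ((Sper lam)%:Z %| c * (Sper lam)%:Z)%Z by apply/dvdz_mull.
rewrite addrC (Tqg_shift q0 (dv a) Sa) -(Tqg_shift q0 (dv b) Sb) addNr.
by [].
Qed.

End Sequences.

Arguments Sper {F} lam.
Arguments Tper {F} lam mu.

Definition Amod (F : fieldType) (q : F) (f g : {poly F}) (lam : Sf f)
  (mu : Tqg q g lam) : Type := laurent F.

Section WeightModule.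
Variables (F : fieldType) (q : F) (f g : {poly F}).
Variables (lam : Sf f) (mu : Tqg q g lam).

(* Amod mu is F[t, t^-1] with h t^i = lam(i) t^i, x t^i = t^(i+1), y t^i = mu(i) t^(i-1). *)
Definition Aop : 'I_3 -> {linear laurent F -> laurent F} :=
  shift_op (fun i : int => i + 1) (fun i : int => i - 1) (fun=> 1) mu lam.

Lemma Aop_rel r : Hrel q f g r -> forall v, free_act Aop r v = 0.
Proof.
apply: shift_op_rel => i.
- by rewrite Sf_eq.
- by rewrite Sf_eq subrK.
- rewrite !mul1r addrK subrK mulr1 -scalerBl Tqg_eq; congr (_ *: _).
  by rewrite addrAC subrr add0r.
Qed.

Local Notation Amod := (Amod mu).
HB.instance Definition _ := GRing.Zmodule.on Amod.

Definition Ascale (a : Hq q f g) (v : Amod) : Amod := Hact Aop a v.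

Lemma AscaleE a v : Ascale (Hpi q f g a) v = free_act Aop a v.
Proof. by rewrite /Ascale (HactE Aop_rel). Qed.

Fact AscaleA a b v : Ascale a (Ascale b v) = Ascale (a * b) v.
Proof.
by rewrite -[a]HliftK -[b]HliftK -(HpiM _ _ _ (Hlift a)) !AscaleE free_actM.
Qed.
Fact Ascale1 : left_id 1 Ascale.
Proof. by move=> v; rewrite [LHS](AscaleE 1 v) free_act1. Qed.
Fact AscaleDr : right_distributive Ascale +%R.
Proof. by move=> a u v; rewrite /Ascale /Hact raddfD. Qed.
Fact AscaleDl v : {morph Ascale^~ v : a b / a + b}.
Proof.
move=> a b; rewrite -[a]HliftK -[b]HliftK -raddfD !AscaleE.
exact: free_actD.
Qed.
HB.instance Definition _ := GRing.Zmodule_isLmodule.Build (Hq q f g) Amod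
  AscaleA Ascale1 AscaleDr AscaleDl.

Definition tA (i : int) : Amod := tpow F i.

Lemma AmodH i : HH q f g *: tA i = lam i *: tpow F i.
Proof. by rewrite [LHS]AscaleE [LHS]shift_actH. Qed.

Lemma AmodX i : HX q f g *: tA i = tpow F (i + 1).
Proof. by rewrite [LHS]AscaleE [LHS]shift_actX scale1r. Qed.

Lemma AmodY i : HY q f g *: tA i = mu i *: tpow F (i - 1).
Proof. by rewrite [LHS]AscaleE [LHS]shift_actY. Qed.

Lemma AmodC (c : F) (v : Amod) : (c%:A : Hq q f g) *: v = c *: (v : laurent F).
Proof.
have -> : c%:A = Hpi q f g (c%:A) by rewrite HpiZ.
by rewrite [LHS]AscaleE free_actZ free_act1.
Qed.

(* The ideal F[t, t^-1] (t^N - gam), N = |lam| |mu|, as a submodule; q != 0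
   is what makes mu periodic of period N. *)
Definition Aideal (q_neq0 : q != 0) (gam : F) : pred Amod := fun v =>
  `[< exists p : laurent F,
        v = p * (tpow F ((Sper lam)%:Z * (Tper lam mu)%:Z) - gam%:A) >].

Lemma wshift_ideal (s : int -> int) (c : int -> F) (N : int) (gam : F)
    (p : laurent F) :
  (forall i, s (i + N) = s i + N) -> (forall i, c (i + N) = c i) ->
  wshift s c (p * (tpow F N - gam%:A) : laurent F) =
  (wshift s c p : laurent F) * (tpow F N - gam%:A).
Proof.
move=> sN cN; elim/laurent_ind: p => [|d k p IH].
  by rewrite linear0 !mul0r linear0.
have E : wshift s c (tpow F k * (tpow F N - gam%:A)) =
   (wshift s c (tpow F k) : laurent F) * (tpow F N - gam%:A).
  rewrite !mulrBr -!scalerAr !mulr1 -tpowD linearB linearZ /=.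
  by rewrite /wshift !linextU sN cN -scalerAl -tpowD.
have WP (e : F) (u v : laurent F) : wshift s c (e *: u + v) =
    e *: (wshift s c u : laurent F) + (wshift s c v : laurent F).
  exact: linearP.
rewrite mulrDl -scalerAl (WP d _ (p * _)) IH (WP d (tpow F k) p) mulrDl -scalerAl.
by rewrite [X in d *: X + _]E.
Qed.

Fact Aideal_submod_closed q0 gam : GRing.submod_closed (Aideal q0 gam).
Proof.
split=> [|a u v /asboolP[p ->] /asboolP[r ->]]; apply/asboolP.
  by exists 0; rewrite mul0r.
set N : int := (Sper lam)%:Z * _; set P := tpow F N - _.
suff [p' ->] : exists p', a *: (p * P : Amod) = (p' * P : laurent F).
  by exists (p' + r); rewrite mulrDl.
rewrite -[a]HliftK [X in exists _, X = _]AscaleE.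
elim/freealg_ind: (Hlift a) => [|c w b [p' E]].
  by exists 0; rewrite free_act0 mul0r.
suff [p'' Ew] : exists p'', foldr (fun i => Aop i) (p * P) w = p'' * P.
  exists (c *: p'' + p'); rewrite [LHS]free_actD E [X in X + _]free_actZ.
  by rewrite free_act_word Ew mulrDl -scalerAl.
have lamN i : lam (i + N) = lam i.
  by apply/esym; move: i; apply/SperP; apply/dvdz_mulr.
have muN i : mu (i + N) = mu i.
  apply: Tqg_shift => //; first exact/dvdz_mulr.
  by rewrite /N mulrC; apply/TperP.
elim: (w : seq _) => [|i s [p'' IH]] /=; first by exists p.
rewrite IH /Aop /shift_op.
case: ifP => _; [|case: ifP => _].
- exists (wshift (fun i : int => i + 1) (fun=> 1) p'').
  by apply: wshift_ideal => // j; rewrite addrAC.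
- exists (wshift (fun i : int => i - 1) mu p'').
  by apply: wshift_ideal => // j; rewrite addrAC.
- by exists (wshift id lam p''); apply: wshift_ideal.
Qed.

HB.instance Definition _ q0 gam :=
  GRing.isSubmodClosed.Build (Hq q f g) Amod (Aideal q0 gam)
    (Aideal_submod_closed q0 gam).

End WeightModule.

Definition Aquot (F : fieldType) (q : F) (f g : {poly F}) (q_neq0 : q != 0)
    (lam : Sf f) (mu : Tqg q g lam) (gam : F) : lmodType (Hq q f g) :=
  lquot (GRing.SubmodClosed.clone _ (Amod mu) (Aideal (mu := mu) q_neq0 gam) _).

(* Main.v *)
From HB Require Import structures.
Require Import Defs.
From mathcomp Require Import all_boot all_order all_algebra.
From mathcomp Require Import monalg boolp.

Set Implicit Arguments.
Unset Strict Implicit.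
Unset Printing Implicit Defensive.

Import Order.TTheory GRing.Theory Num.Theory.
Local Open Scope ring_scope.

(** Write [n = |lam|], [m = |mu|] and [N = n * m].  On the Laurent polynomials
the basis vector [t^i] is a joint eigenvector of [h] and of [x * y], with the
pair of eigenvalues [(lam i, mu i)].  Both operators, and more generally every
diagonal operator with [N]-periodic coefficients, preserve the ideal of
[t^N - gam], so they still act on the quotient.

Suppose that [phi] is an injective morphism between two such quotients.  The
class of [1] is nonzero, and its image is a nonzero joint eigenvector with
eigenvalues [(lam 0, mu 0)].  In the target only the pairs [(lam' a, mu' a)]
can occur ([joint_weight]), so [lam' a = lam 0] and [mu' a = mu 0] for some
integer [a].  The recursions defining the two kinds of sequences propagate
such a coincidence to all indices: forwards for [lam], backwards too thanks to
periodicity ([Sf_rigid]), and in both directions for [mu] because [q] is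
nonzero ([Tqg_rigid]).  Hence [(lam', mu')] is a shift of [(lam, mu)], the
periods agree, and [x^N] acts by [gam] on one side and by [gam'] on the other
([Aquot_Xn]), whence [gam = gam'].

Conversely, if [(lam', mu')] is [(lam, mu)] shifted by [s], multiplication by
[t^(- s)] intertwines the two actions ([Amod_shift]) and commutes with
multiplication by [t^N - gam], so it descends to the quotients; the inverse
comes from multiplication by [t^s] ([Aquot_shift_iso]).

Finally a shift by [s] only depends on [s] modulo [N], and each residue
modulo [N] is [i + j * n] for one [i < n] and one [j < m]. *)

(** * Sequences determined by one value *)

Section Rigidity.
Variables (F : fieldType) (q : F) (f g : {poly F}).

(** The difference of two solutions of the recursion of [mu] over the same
[lam] satisfies [e (k + 1) = q * e k]; as [q] is nonzero, it vanishes
everywhere as soon as it vanishes at one index. *)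
Lemma Tqg_rigid (lam lam' : Sf f) (mu : Tqg q g lam) (mu' : Tqg q g lam')
    (s i : int) : q != 0 -> (forall k, lam' k = lam (k + s)) ->
  mu' i = mu (i + s) -> forall k, mu' k = mu (k + s).
Proof.
move=> q0 lams mui.
pose e k := mu' k - mu (k + s).
have eS k : (e (k + 1) == 0) = (e k == 0).
  have -> : e (k + 1) = q * e k.
    rewrite /e addrAC !Tqg_eq lams opprD addrACA subrr addr0.
    by rewrite mulrBr.
  by rewrite mulf_eq0 (negPf q0).
have e0 k : (e k == 0) = (e 0 == 0).
  elim/int_ind: k => [//|n IH|n IH]; first by rewrite -addn1 PoszD eS.
  by rewrite -IH -eS -addn1 PoszD opprD subrK.
move=> k; apply/eqP; rewrite -subr_eq0 -/(e k) e0 -(e0 i).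
by rewrite /e mui subrr.
Qed.

(** Iterating [f] only reaches indices to the right of a coincidence; negative
indices are first moved to the right by a multiple of both periods. *)
Lemma Sf_rigid (lam lam' : Sf f) (a : int) :
  (0 < Sper lam)%N -> (0 < Sper lam')%N ->
  lam' a = lam 0 -> forall k, lam' (k + a) = lam k.
Proof.
move=> n_gt0 n'_gt0 lama k.
have nonneg (n : nat) : lam' (n%:Z + a) = lam n%:Z.
  elim: n => [|n IH]; first by rewrite add0r.
  by rewrite -addn1 PoszD addrAC -!Sf_eq IH.
(* A common period of lam and lam' that is at least |k|. *)
pose M := (`|k| * (Sper lam * Sper lam'))%N.
have kM : k + M%:Z = (absz (k + M%:Z))%:Z.
  rewrite gez0_abs // -lerBlDl sub0r (le_trans (ler_norm _)) // normrN.
  by rewrite -abszE lez_nat leq_pmulr // muln_gt0 n_gt0.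
have perM (l : Sf f) : (Sper l %| Sper lam * Sper lam')%N ->
    forall j, l j = l (j + M%:Z).
  by move=> dl; apply/SperP; rewrite dvdzE /= dvdn_mull.
rewrite (perM lam') ?dvdn_mull // (perM lam) ?dvdn_mulr //.
by rewrite addrAC kM nonneg.
Qed.

Lemma Sper_shift (lam lam' : Sf f) (s : int) :
  (forall k, lam' k = lam (k + s)) -> Sper lam' = Sper lam.
Proof.
move=> lams; rewrite /Sper; congr zgen; apply/funext => k /=; apply/propext.
split=> per i; last by rewrite !lams per addrAC.
by have := per (i - s); rewrite !lams [_ + k + s]addrAC !subrK.
Qed.

Lemma Tper_shift (lam lam' : Sf f) (mu : Tqg q g lam) (mu' : Tqg q g lam')
    (s : int) : q != 0 -> (forall k, lam' k = lam (k + s)) ->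
  (forall k, mu' k = mu (k + s)) -> Tper lam' mu' = Tper lam mu.
Proof.
move=> q0 lams mus; rewrite /Tper; congr zgen; apply/funext => k /=.
rewrite (Sper_shift lams) !mus add0r.
have lamd : forall i, lam i = lam (i + k * (Sper lam)%:Z).
  by apply/SperP; apply/dvdz_mull.
apply/propext; split=> mud.
  have := @Tqg_rigid _ _ mu mu _ s q0 lamd _ 0.
  by rewrite add0r => <- //; rewrite addrC mud.
rewrite addrC; apply/esym.
have := @Tqg_rigid _ _ mu mu _ 0 q0 lamd _ s.
by rewrite add0r => ->.
Qed.

End Rigidity.

(** * Action of the generators *)

(** Multiplication by [t^s], named so as to carry an instance of a linear
map. *)
Definition tmul (F : fieldType) (s : int) (w : laurent F) : laurent F :=
  tpow F s * w.

Fact tmul_is_linear (F : fieldType) (s : int) : linear (@tmul F s).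
Proof. by move=> c u v; rewrite /tmul mulrDr scalerAr. Qed.

HB.instance Definition _ (F : fieldType) (s : int) :=
  GRing.isLinear.Build F (laurent F) (laurent F) *:%R (@tmul F s)
    (@tmul_is_linear F s).

Lemma tmul_tpow (F : fieldType) (s k : int) : tmul s (tpow F k) = tpow F (s + k).
Proof. by rewrite [RHS]tpowD. Qed.

Section Quotient.
Variables (F : fieldType) (q : F) (f g : {poly F}) (q_neq0 : q != 0).
Variables (lam : Sf f) (mu : Tqg q g lam).

(** The exponent [N = |lam| |mu|], which is a period of both sequences. *)
Definition jper : int := (Sper lam)%:Z * (Tper lam mu)%:Z.

Lemma lam_jper i : lam (i + jper) = lam i.
Proof. by apply/esym; move: i; apply/SperP/dvdz_mulr. Qed.

Lemma mu_jper i : mu (i + jper) = mu i.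
Proof.
apply: Tqg_shift => //; first exact/dvdz_mulr.
by rewrite /jper mulrC; apply/TperP.
Qed.

(** The projection onto the quotient, with domain and codomain stated as
modules over the algebra. *)
Definition Api (gam : F) (v : Amod mu) : Aquot q_neq0 mu gam :=
  lquot_pi (GRing.SubmodClosed.clone _ (Amod mu) (Aideal (mu := mu) q_neq0 gam) _) v.

Definition Arepr (gam : F) (v : Aquot q_neq0 mu gam) : Amod mu := lquot_repr v.

Lemma AreprK gam (u : Aquot q_neq0 mu gam) : Api gam (Arepr u) = u.
Proof. exact: lquot_reprK. Qed.

Lemma ApiZ gam a v : Api gam (a *: v) = a *: Api gam v.
Proof. exact: lquot_piZ. Qed.

Lemma ApiD gam u v : Api gam (u + v) = Api gam u + Api gam v.
Proof. exact: raddfD. Qed.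

Lemma Api_eq gam (u v : Amod mu) : Api gam u = Api gam v <->
  exists p : laurent F, u - v = p * (tpow F jper - gam%:A).
Proof.
split; first by move/lquot_eq/asboolP.
by move=> uv; apply/lquot_eq/asboolP.
Qed.

Lemma AmodH_mask (w : Amod mu) : HH q f g *: w = wshift id lam w.
Proof.
rewrite [LHS]AscaleE; move: w; apply: eq_linmalg => k.
by rewrite [LHS]shift_actH [RHS]linextU.
Qed.

Lemma AmodXY_mask (w : Amod mu) : (HX q f g * HY q f g) *: w = wshift id mu w.
Proof.
rewrite -HpiM [LHS]AscaleE; move: w; apply: eq_linmalg => k.
rewrite [LHS]free_actM shift_actY [LHS]linearZ /= shift_actX [RHS]linextU.
by rewrite scale1r subrK.
Qed.

Lemma AmodX_tpow (w : Amod mu) : HX q f g *: w = tmul 1 w.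
Proof.
rewrite [LHS]AscaleE; move: w; apply: eq_linmalg => k.
by rewrite [LHS]shift_actX [RHS]tmul_tpow scale1r addrC.
Qed.

Lemma AmodXn_tpow (n : nat) (w : Amod mu) :
  HX q f g ^+ n *: w = tpow F n%:Z * (w : laurent F).
Proof.
elim: n => [|n IH]; first by rewrite expr0 scale1r tpow0 mul1r.
by rewrite exprS -scalerA IH AmodX_tpow /tmul mulrA -tpowD -intS.
Qed.

(** On Laurent polynomials [x^N - gam] is multiplication by [t^N - gam]. *)
Lemma Aquot_Xn (gam : F) (u : Aquot q_neq0 mu gam) :
  HX q f g ^+ (Sper lam * Tper lam mu) *: u = gam%:A *: u.
Proof.
rewrite -[u]AreprK -!ApiZ; apply/Api_eq; exists (Arepr u).
by rewrite AmodC AmodXn_tpow PoszM mulrC mulrBr -scalerAr mulr1.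
Qed.

Lemma Api_tH gam i :
  HH q f g *: Api gam (tA mu i) = (lam i)%:A *: Api gam (tA mu i).
Proof. by rewrite -2!ApiZ; congr (Api gam _); rewrite AmodC AmodH. Qed.

Lemma Api_tXY gam i :
  (HX q f g * HY q f g) *: Api gam (tA mu i) = (mu i)%:A *: Api gam (tA mu i).
Proof.
rewrite -2!ApiZ; congr (Api gam _); rewrite AmodC AmodXY_mask.
exact: linextU.
Qed.

(** * Joint eigenvectors in the quotient *)

(** [wshift id c] is the diagonal operator with entries [c].  If the entries
of [d1] and [d2] have no common zero, then a vector is recovered from its
images under both diagonal operators. *)
Lemma mask_bezout (c1 d1 c2 d2 : int -> F) (w : laurent F) :
  (forall k, c1 k * d1 k + c2 k * d2 k = 1) ->
  w = wshift id c1 (wshift id d1 w) + wshift id c2 (wshift id d2 w).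
Proof.
move=> cd; rewrite -[LHS]/(idfun w); move: w.
pose mask c := GRing.Linear.clone F _ _ _ (@wshift F int id c) _.
apply: (eq_linmalg (a := idfun)
  (b := (mask c1 \o mask d1) \+ (mask c2 \o mask d2))).
move=> k; rewrite /= /wshift !linextU !linearZ /= !linextU !scalerA -scalerDl.
by rewrite ![d1 k * _]mulrC ![d2 k * _]mulrC cd scale1r.
Qed.

(** Let [w] represent a joint eigenvector.  The diagonal operators with entries
[lam k - alpha] and [mu k - beta] send [w] into the ideal.  If they had no
common zero, [w] would be a combination of these two images by [N]-periodic
diagonal operators, which preserve the ideal, so [w] would be in the ideal
too. *)
Lemma joint_weight (gam alpha beta : F) (v : Aquot q_neq0 mu gam) :
  v != 0 -> HH q f g *: v = alpha%:A *: v ->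
  (HX q f g * HY q f g) *: v = beta%:A *: v ->
  exists a : int, lam a = alpha /\ mu a = beta.
Proof.
move=> v0; rewrite -[v]AreprK -!ApiZ; set w := Arepr v.
move=> /Api_eq[p1]; rewrite AmodH_mask AmodC => E1.
move=> /Api_eq[p2]; rewrite AmodXY_mask AmodC => E2.
apply: contrapT => no_a; case/eqP: v0.
(* c2 is supported on the zeros of d1, where d2 is invertible; with c1 the
   inverse of d1 elsewhere, this solves c1 * d1 + c2 * d2 = 1. *)
pose d1 k := lam k - alpha; pose d2 k := mu k - beta.
pose c1 k := (d1 k)^-1; pose c2 k := if d1 k == 0 then (d2 k)^-1 else 0.
have cd k : c1 k * d1 k + c2 k * d2 k = 1.
  rewrite /c1 /c2; case: eqVneq => [d10|d10]; last by rewrite mulVf // mul0r addr0.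
  rewrite d10 mulr0 add0r mulVf //; apply/eqP => d20; apply: no_a.
  by exists k; split; apply/eqP; rewrite -subr_eq0; apply/eqP.
have maskB (l : int -> F) (b : F) (u : laurent F) :
    wshift id (fun k => l k - b) u = wshift id l u - b *: u.
  elim/malg_ind_lin: u => [|c k u IH]; first by rewrite !linear0 addr0.
  rewrite !linearP /= IH [RHS]addrACA; congr (_ + _).
  by rewrite /wshift !linextU scalerBl -scalerDr.
have F1 : wshift id d1 w = p1 * (tpow F jper - gam%:A) by rewrite -E1 maskB.
have F2 : wshift id d2 w = p2 * (tpow F jper - gam%:A) by rewrite -E2 maskB.
rewrite -[v]AreprK -/w -[RHS](scale0r (Api gam w)) -ApiZ; apply/Api_eq.
exists ((wshift id c1 p1 : laurent F) + wshift id c2 p2).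
rewrite scale0r subr0 (mask_bezout w cd) F1 F2 mulrDl.
congr (_ + _); apply: wshift_ideal => // k; rewrite /c1 /c2 /d1 /d2.
  by rewrite lam_jper.
by rewrite lam_jper mu_jper.
Qed.

(** The ideal is proper: the linear form sending [t^(N * k)] to [gam ^ k], and
the other powers of [t] to [0], vanishes on the ideal but not at [1]. *)
Lemma Aquot_pi1_neq0 (gam : F) : gam != 0 ->
  (0 < Sper lam)%N -> (0 < Tper lam mu)%N -> Api gam (tA mu 0) != 0.
Proof.
move=> gam0 n0 m0.
have N0 : jper != 0 by rewrite mulf_neq0 // -lt0n.
pose c k : F^o := if (jper %| k)%Z then gam ^ (k %/ jper)%Z else 0.
apply/eqP; rewrite -[RHS](scale0r (Api gam (tA mu 0))) -ApiZ => /Api_eq[p].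
rewrite scale0r subr0 => E.
have : linext c (tA mu 0) = linext c (p * (tpow F jper - gam%:A)) by rewrite E.
rewrite linextU /c dvdz0 div0z expr0z => E1.
suff E2 : linext c (p * (tpow F jper - gam%:A)) = 0.
  by move/eqP: E1; rewrite E2 oner_eq0.
elim/laurent_ind: p {E E1} => [|d k p IH]; first by rewrite mul0r linear0.
rewrite mulrDl linearD [X in _ + X]IH addr0 -scalerAl linearZ.
rewrite mulrBr -scalerAr mulr1 -tpowD linearB linearZ /= !linextU /c.
have -> : (jper %| k + jper)%Z = (jper %| k)%Z by apply: rpredDr; apply: dvdzz.
rewrite divzDr ?dvdzz // divzz N0.
case: ifP => _; last by rewrite scaler0 subr0 scaler0.
by rewrite expfzDr // expr1z mulrC subrr scaler0.
Qed.

End Quotient.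

(** * Shifted sequences give isomorphic quotients *)

Section Shift.

Lemma free_act_morph (R : comNzRingType) (V W : lmodType R)
    (op : 'I_3 -> {linear V -> V}) (op' : 'I_3 -> {linear W -> W})
    (T : {linear V -> W}) :
  (forall i v, T (op i v) = op' i (T v)) ->
  forall a v, T (free_act op a v) = free_act op' a (T v).
Proof.
move=> opT a v; elim/freealg_ind: a => [|c w a IH].
  by rewrite !free_act0 linear0.
rewrite !free_actD !free_actZ linearP IH !free_act_word; congr (_ *: _ + _).
by elim: (w : seq _) => //= i s <-.
Qed.

Variables (F : fieldType) (q : F) (f g : {poly F}) (q_neq0 : q != 0).

Variables (lam lam' : Sf f) (mu : Tqg q g lam) (mu' : Tqg q g lam') (s : int).
Hypothesis lams : forall k, lam' k = lam (k + s).
Hypothesis mus : forall k, mu' k = mu (k + s).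

(** The weights of [t^(k - s)] in the second module are those of [t^k] in the
first one, so multiplication by [t^(- s)] commutes with the three
generators. *)
Lemma Amod_shift (a : Hq q f g) (v : Amod mu) :
  tmul (- s) (a *: v) = (a *: (tmul (- s) v : Amod mu')) :> laurent F.
Proof.
rewrite -[a]HliftK [X in tmul _ X]AscaleE [RHS]AscaleE.
apply: free_act_morph => i; rewrite /Aop /shift_op.
(* Each generator acts as a weighted shift, so one computation on the basis
   covers the three cases below. *)
have comm (sx : int -> int) (c c' : int -> F) (w : laurent F) :
    (forall k, sx (- s + k) = - s + sx k) -> (forall k, c' (- s + k) = c k) ->
    tmul (- s) (wshift sx c w) = wshift sx c' (tmul (- s) w).
  move=> sxs cs.
  pose sh c := GRing.Linear.clone F _ _ _ (@wshift F int sx c) _.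
  pose tm := GRing.Linear.clone F _ _ _ (@tmul F (- s)) _.
  move: w; apply: (eq_linmalg (a := tm \o sh c) (b := sh c' \o tm)) => k.
  rewrite /= [tmul _ << k >>](tmul_tpow F (- s) k) /wshift !linextU linearZ /=.
  by rewrite [tmul _ _](tmul_tpow F (- s) (sx k)) sxs cs.
case: ifP => _; [|case: ifP => _] => w; apply: comm => // k.
- by rewrite addrA.
- by rewrite addrA.
- by rewrite mus addrAC addNr add0r.
- by rewrite lams addrAC addNr add0r.
Qed.

(** Multiplication by [t^(- s)] maps the first ideal into the second one,
because shifted sequences have the same periods. *)
Lemma Api_shift (gam : F) (u v : Amod mu) : Api q_neq0 gam u = Api q_neq0 gam v ->
  Api q_neq0 gam (tmul (- s) u : Amod mu') = Api q_neq0 gam (tmul (- s) v : Amod mu').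
Proof.
move=> /Api_eq[p E]; apply/Api_eq; exists (tmul (- s) p).
rewrite -[LHS]linearB /= E /tmul mulrA /jper (Sper_shift lams).
by rewrite (Tper_shift q_neq0 lams mus).
Qed.

Definition Aquot_shift (gam : F) (u : Aquot q_neq0 mu gam) :
  Aquot q_neq0 mu' gam := Api q_neq0 gam (tmul (- s) (Arepr u) : Amod mu').

Lemma Aquot_shiftE (gam : F) (v : Amod mu) :
  Aquot_shift (Api q_neq0 gam v) = Api q_neq0 gam (tmul (- s) v : Amod mu').
Proof. by apply: Api_shift; rewrite AreprK. Qed.

Lemma Aquot_shift_is_linear (gam : F) : linear (@Aquot_shift gam).
Proof.
move=> a u v; rewrite -[u]AreprK -[v]AreprK -ApiZ -ApiD !Aquot_shiftE.
rewrite -ApiZ -ApiD; congr (Api q_neq0 gam _).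
by rewrite [LHS]linearD /= Amod_shift.
Qed.

(** The proof of linearity depends on the hypotheses on [s], which the function
[Aquot_shift] does not mention: the linear map is given by an existence
statement, as no instance on [Aquot_shift] could be inferred. *)
Lemma Aquot_shift_linear (gam : F) :
  exists phi : {linear Aquot q_neq0 mu gam -> Aquot q_neq0 mu' gam},
    phi =1 @Aquot_shift gam.
Proof.
pose lin := GRing.isLinear.Build (Hq q f g) (Aquot q_neq0 mu gam)
  (Aquot q_neq0 mu' gam) *:%R (@Aquot_shift gam) (@Aquot_shift_is_linear gam).
pose phi : {linear Aquot q_neq0 mu gam -> Aquot q_neq0 mu' gam} :=
  HB.pack (@Aquot_shift gam) lin.
by exists phi.
Qed.

End Shift.

Lemma Aquot_shiftK (F : fieldType) (q : F) (f g : {poly F}) (q_neq0 : q != 0)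
    (lam lam' : Sf f) (mu : Tqg q g lam) (mu' : Tqg q g lam') (s : int)
    (lams : forall k, lam' k = lam (k + s))
    (mus : forall k, mu' k = mu (k + s))
    (lams' : forall k, lam k = lam' (k - s))
    (mus' : forall k, mu k = mu' (k - s)) (gam : F) :
  cancel (@Aquot_shift F q f g q_neq0 lam lam' mu mu' s gam)
         (@Aquot_shift F q f g q_neq0 lam' lam mu' mu (- s) gam).
Proof.
move=> u; rewrite -[u]AreprK (Aquot_shiftE q_neq0 lams mus).
rewrite (Aquot_shiftE q_neq0 lams' mus').
by rewrite /tmul mulrA -tpowD addNr tpow0 mul1r.
Qed.

Lemma Aquot_shift_iso (F : fieldType) (q : F) (f g : {poly F})
    (q_neq0 : q != 0) (lam lam' : Sf f) (mu : Tqg q g lam)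
    (mu' : Tqg q g lam') (s : int) (gam : F) :
  (forall k, lam' k = lam (k + s)) -> (forall k, mu' k = mu (k + s)) ->
  exists phi : {linear Aquot q_neq0 mu gam -> Aquot q_neq0 mu' gam},
    bijective phi.
Proof.
move=> lams mus.
have lams' k : lam k = lam' (k - s) by rewrite lams subrK.
have mus' k : mu k = mu' (k - s) by rewrite mus subrK.
have [phi phiE] := Aquot_shift_linear q_neq0 lams mus gam.
exists phi; exists (@Aquot_shift _ _ _ _ q_neq0 _ _ mu' mu (- s) gam) => u.
  by rewrite phiE; apply: Aquot_shiftK.
by rewrite phiE -{1}[s]opprK; apply: Aquot_shiftK => // k; rewrite opprK.
Qed.

(** * Isomorphic quotients come from shifted sequences *)

Lemma linear_scale_eq (R : pzRingType) (U V : lmodType R) (phi : {linear U -> V})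
    (a b : R) (u : U) :
  a *: u = b *: u -> a *: phi u = b *: phi u.
Proof. by move=> E; rewrite -!linearZ E. Qed.

(** The image of the class of [1] has weights [(lam 0, mu 0)] and is nonzero;
this gives an index [a] with [lam' a = lam 0] and [mu' a = mu 0], and the
shift is [- a].  Comparing the actions of [x^N] on this image then
identifies [gam] and [gam']. *)
Lemma Aquot_iso_inv (F : fieldType) (q : F) (q_neq0 : q != 0)
    (f g : {poly F}) (lam lam' : Sf f)
    (mu : Tqg q g lam) (mu' : Tqg q g lam') (gam gam' : F)
    (phi : {linear Aquot q_neq0 mu gam -> Aquot q_neq0 mu' gam'}) :
  gam != 0 -> (0 < Sper lam)%N -> (0 < Sper lam')%N -> (0 < Tper lam mu)%N ->
  injective phi ->
  gam = gam' /\ exists s : int,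
    (forall k, lam' k = lam (k + s)) /\ (forall k, mu' k = mu (k + s)).
Proof.
move=> gam0 n0 n'0 m0 phi_inj.
pose e := Api q_neq0 gam (tA mu 0).
have v0 : phi e != 0.
  by rewrite -(linear0 phi) (inj_eq phi_inj) Aquot_pi1_neq0.
have [|| a [lama mua]] := @joint_weight _ _ _ _ _ _ mu' gam' (lam 0) (mu 0) _ v0.
- exact: linear_scale_eq (Api_tH _ _ _ _).
- exact: linear_scale_eq (Api_tXY _ _ _ _).
have lams k : lam' k = lam (k + (- a)).
  by rewrite -(Sf_rigid n0 n'0 lama) subrK.
have mus k : mu' k = mu (k + (- a)).
  by apply: (Tqg_rigid q_neq0 lams (i := a)); rewrite subrr.
split; last by exists (- a).
have X1 := Aquot_Xn (phi e).
rewrite (Sper_shift lams) (Tper_shift q_neq0 lams mus) in X1.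
move: X1; rewrite (linear_scale_eq phi (Aquot_Xn e)) => /eqP.
rewrite -subr_eq0 -scalerBl -scalerBl => /eqP E.
apply/eqP; rewrite -subr_eq0; apply: contraNT v0 => d0.
rewrite -[phi e]scale1r -[1 : Hq q f g]scale1r -(mulVf d0) -scalerA.
by rewrite -[_ *: (_ *: 1)]mulr_algl -scalerA E scaler0.
Qed.

Theorem proposition3p20 (F : closedFieldType) (q : F) (q_neq0 : q != 0)
    (f g : {poly F}) (lam lam' : Sf f)
    (mu : Tqg q g lam) (mu' : Tqg q g lam') (gam gam' : F)
    (gam_neq0 : gam != 0) (gam'_neq0 : gam' != 0)
    (lam_per : (1 <= Sper lam)%N) (lam'_per : (1 <= Sper lam')%N)
    (mu_per : (1 <= Tper lam mu)%N) (mu'_per : (1 <= Tper lam' mu')%N) :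
  (exists phi : {linear Aquot q_neq0 mu gam -> Aquot q_neq0 mu' gam'},
     bijective phi)
  <->
  (gam = gam' /\
   exists i j : nat, [/\ (i < Sper lam)%N, (j < Tper lam mu)%N &
     forall k : int, lam' k = lam (k + i%:Z) /\
       mu' k = mu (k + i%:Z + j%:Z * (Sper lam)%:Z)]).
Proof.
split=> [[phi /bij_inj phi_inj]|[<- [i [j [_ _ lm]]]]]; last first.
  apply: (@Aquot_shift_iso _ _ _ _ _ _ _ _ _ (i%:Z + j%:Z * (Sper lam)%:Z)) => k.
    have [-> _] := lm k; rewrite addrA.
    by move: (k + _); apply/SperP/dvdz_mull.
  by have [_ ->] := lm k; rewrite addrA.
have [<- [s [lams mus]]] :=
  Aquot_iso_inv gam_neq0 lam_per lam'_per mu_per phi_inj.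
split=> //.
set n := Sper lam; set m := Tper lam mu.
have n0 : n%:Z != 0 by rewrite -lt0n.
have m0 : m%:Z != 0 by rewrite -lt0n.
have modE (d : int) (x : nat) : x%:Z != 0 -> (d %% x%:Z)%Z = `|d %% x%:Z|%Z%N.
  by move=> x0; rewrite gez0_abs ?modz_ge0.
have modlt (d : int) (x : nat) : x%:Z != 0 -> (`|d %% x%:Z|%Z%N < x)%N.
  by move=> x0; rewrite -ltz_nat -modE // ltz_mod.
(* Only s modulo n * m matters: i is the residue of s modulo n, and j that of
   the quotient modulo m. *)
exists `|s %% n|%Z%N, `|(s %/ n)%Z %% m|%Z%N; split; try exact: modlt.
move=> k; rewrite -!modE //.
have sE := divz_eq s n; have cE := divz_eq (s %/ n)%Z m.
split.
  rewrite lams {1}sE addrA addrAC; apply/esym; move: (k + _).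
  by apply/SperP/dvdz_mull.
rewrite mus; have -> : k + s = k + (s %% n)%Z + ((s %/ n)%Z %% m)%Z * n%:Z
    + ((s %/ n)%Z %/ m)%Z * m%:Z * n%:Z.
  rewrite {1}sE {1}cE mulrDl -addrA [X in k + X]addrC addrA.
  by rewrite -[in RHS](addrA k) [(s %% n)%Z + _]addrC.
apply: Tqg_shift => //; first exact/dvdz_mull.
by apply/TperP => //; apply/dvdz_mull.
Qed.
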